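(* Let $M$ be a positive real number. There exists a positive real number $\gamma$, depending only on $M$, such that for every non-zero real number $\xi\in[-M,M]$ and every sequence $(\eta_n)_{n\ge1}$ of real numbers, and for every $\delta>0$, there exists a real number $\varepsilon$ with $0<\varepsilon<\delta$ satisfying $$\inf_{n \ge 1} \, \Vert \xi (1 + \varepsilon)^n + \eta_n \Vert > \gamma\, \varepsilon\, |\log \varepsilon|^{-1}.$$
   Context: For a real number $x$, $\Vert x \Vert$ denotes the distance from $x$ to the nearest integer. $\log$ denotes the natural logarithm. The infimum is over all positive integers $n$. *)

(* Defs.v *)
From Stdlib Require Import Reals.
Open Scope R_scope.

Definition dist_Z (x : R) : R :=
  Rmin (x - IZR (Int_part x)) (IZR (Int_part x) + 1 - x).

(* inf_{n >= 1} f n > c, unfolded: some bound strictly above c is a lower bound *)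
Definition inf_pos_gt (f : nat -> R) (c : R) : Prop :=
  exists c', c < c' /\ forall n : nat, (1 <= n)%nat -> c' <= f n.

(* Main.v *)
(** This is a Peres-Schlag argument. Fix [e = 2^-i] and look for [eps] in [[e, 2e]]. For each
    exponent [n], the [eps] for which [xi (1 + eps)^n + eta_n] is within [rho] of an integer form
    small intervals, of density about [2 rho] as soon as the [n]-th map stretches the current
    interval to length at least [1]. With [rho] of order [e / |log e|], a block of
    [h ~ |log e| / e] consecutive exponents removes only a small proportion, while the derivatives
    grow by a factor [(1 + e)^h] that is polynomially large in [1 / e]. Hence an interval that
    has lost at most half of its length to the previous block can be cut so finely that some
    piece avoids that block entirely and loses at most half of its length to the next one;
    iterating gives nested intervals.

    For the first block the maps with small [n] do not stretch enough. Such an [n] can remove a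
    piece only when its orbit crosses an integer, which over all dyadic scales of [eps] happens a
    bounded number of times. Averaging over the scales, with weight [1 / n], yields arbitrarily
    small scales [e] at which these exponents remove only a proportion [O(1 / |log e|)], with a
    constant depending on [xi]. *)
Require Import Defs.
From Stdlib Require Import Reals Lra Lia ZArith IndefiniteDescription.
Open Scope R_scope.

(** * Finite sums and pigeonhole principles *)

Fixpoint psum (F : nat -> R) (n : nat) : R :=
  match n with
  | O => 0
  | S p => psum F p + F p
  end.

Lemma psum_le (F G : nat -> R) (n : nat) :
  (forall i, (i < n)%nat -> F i <= G i) -> psum F n <= psum G n.
Proof.
  induction n as [|n IH]; intros H; simpl; [lra|].
  assert (psum F n <= psum G n) by (apply IH; intros; apply H; lia).
  assert (F n <= G n) by (apply H; lia). lra.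
Qed.

Lemma psum_const (c : R) (n : nat) : psum (fun _ => c) n = INR n * c.
Proof.
  induction n as [|n IH]; [simpl; ring|].
  rewrite S_INR. simpl psum. rewrite IH. ring.
Qed.

Lemma psum_bound (F : nat -> R) (c : R) (n : nat) :
  (forall i, (i < n)%nat -> F i <= c) -> psum F n <= INR n * c.
Proof. intros H. rewrite <- psum_const. now apply psum_le. Qed.

Lemma psum_ge0 (F : nat -> R) (n : nat) :
  (forall i, (i < n)%nat -> 0 <= F i) -> 0 <= psum F n.
Proof.
  intros H. apply psum_le in H. rewrite psum_const in H. lra.
Qed.

Lemma psum_plus (F G : nat -> R) (n : nat) :
  psum (fun i => F i + G i) n = psum F n + psum G n.
Proof. induction n as [|n IH]; simpl; [|rewrite IH]; ring. Qed.

Lemma psum_minus (F G : nat -> R) (n : nat) :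
  psum (fun i => F i - G i) n = psum F n - psum G n.
Proof. induction n as [|n IH]; simpl; [|rewrite IH]; ring. Qed.

Lemma psum_scal (c : R) (F : nat -> R) (n : nat) :
  psum (fun i => c * F i) n = c * psum F n.
Proof. induction n as [|n IH]; simpl; [|rewrite IH]; ring. Qed.

Lemma psum_split (F : nat -> R) (n m : nat) :
  psum F (n + m) = psum F n + psum (fun i => F (n + i)%nat) m.
Proof.
  induction m as [|m IH]; [rewrite Nat.add_0_r; simpl; ring|].
  rewrite Nat.add_succ_r. simpl. rewrite IH. ring.
Qed.

Lemma psum_le_length (F : nat -> R) (n m : nat) :
  (n <= m)%nat -> (forall i, (i < m)%nat -> 0 <= F i) -> psum F n <= psum F m.
Proof.
  intros Hnm H. replace m with (n + (m - n))%nat by lia. rewrite psum_split.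
  assert (0 <= psum (fun i => F (n + i)%nat) (m - n))
    by (apply psum_ge0; intros; apply H; lia).
  lra.
Qed.

Lemma psum_term_le (F : nat -> R) (n i : nat) :
  (forall j, (j < n)%nat -> 0 <= F j) -> (i < n)%nat -> F i <= psum F n.
Proof.
  intros H Hi.
  assert (0 <= psum F i) by (apply psum_ge0; intros; apply H; lia).
  assert (psum F (S i) <= psum F n) by (apply psum_le_length; auto).
  simpl in *. lra.
Qed.

Lemma psum_swap (F : nat -> nat -> R) (n m : nat) :
  psum (fun i => psum (F i) m) n = psum (fun j => psum (fun i => F i j) n) m.
Proof.
  induction n as [|n IH]; simpl.
  - rewrite psum_const. ring.
  - rewrite IH, <- psum_plus. reflexivity.
Qed.

Lemma psum_pigeonhole (F : nat -> R) (n : nat) (c : R) :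
  psum F n < INR n * c -> exists i, (i < n)%nat /\ F i < c.
Proof.
  induction n as [|n IH]; intros H; [simpl in H; lra|].
  destruct (Rlt_le_dec (F n) c) as [Hc|Hc]; [exists n; split; [lia|easy]|].
  rewrite S_INR in H. simpl psum in H.
  destruct IH as [i [Hi Hc']]; [lra|]. exists i; split; [lia|easy].
Qed.

(** The increments of [F] over [n] adjacent pieces telescope, so one of them is below average. It
    serves to select a subinterval that loses little. *)
Lemma interval_pigeonhole (F : R -> R) (u l c : R) (n : nat) :
  F (u + INR n * l) - F u < INR n * c ->
  exists i, (i < n)%nat /\ F (u + INR i * l + l) - F (u + INR i * l) < c.
Proof.
  intros H. apply (psum_pigeonhole (fun i => F (u + INR i * l + l) - F (u + INR i * l))).
  replace (psum _ n) with (F (u + INR n * l) - F u); [exact H|].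
  clear H. induction n as [|n IH].
  - simpl. replace (u + 0 * l) with u by ring. ring.
  - simpl psum. rewrite <- IH, S_INR.
    replace (u + (INR n + 1) * l) with (u + INR n * l + l) by ring. ring.
Qed.

(** * Distance to the integers and the measure of their neighbourhoods *)

Definition floor (y : R) : R := IZR (Int_part y).

Lemma floor_bounds (y : R) : floor y <= y < floor y + 1.
Proof. unfold floor. destruct (base_Int_part y). lra. Qed.

Lemma IZR_le_of_lt (a b : Z) : IZR a < IZR b + 1 -> IZR a <= IZR b.
Proof.
  intros H. apply IZR_le. apply Z.lt_succ_r. apply lt_IZR.
  unfold Z.succ. rewrite plus_IZR. exact H.
Qed.

Lemma floor_ge (y : R) (z : Z) : IZR z <= y -> IZR z <= floor y.
Proof.
  intros H. apply IZR_le_of_lt. pose proof (floor_bounds y). unfold floor in *. lra.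
Qed.

Lemma floor_le (x y : R) : x <= y -> floor x <= floor y.
Proof. intros H. apply floor_ge. pose proof (floor_bounds x). unfold floor in *. lra. Qed.

(** Quantifying over all integers makes the symmetry under negation immediate, which later reduces
    the theorem to positive [xi]. *)
Definition far (rho y : R) : Prop := forall z : Z, rho <= Rabs (y - IZR z).

Lemma far_dist_Z (rho y : R) : far rho y -> rho <= dist_Z y.
Proof.
  intros H. unfold dist_Z. pose proof (H (Int_part y)) as H1.
  pose proof (H (Int_part y + 1)%Z) as H2. rewrite plus_IZR in H2.
  destruct (base_Int_part y).
  apply Rmin_glb; unfold Rabs in *; destruct Rcase_abs in H1; destruct Rcase_abs in H2; lra.
Qed.

Lemma far_opp (rho y : R) : far rho y -> far rho (- y).
Proof.
  intros H z. specialize (H (- z)%Z). rewrite opp_IZR in H.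
  rewrite <- Rabs_Ropp. now replace (- (- y - IZR z)) with (y - - IZR z) by ring.
Qed.

(* A primitive of the indicator function of the set of reals at distance less than [rho] from
   the integers, normalised by [hit_len rho 0 = 0]. *)
Definition hit_len (rho y : R) : R :=
  2 * rho * floor (y + / 2) + Rmax (- rho) (Rmin rho (y - floor (y + / 2))).

Ltac clamp := unfold Rmax, Rmin in *; repeat destruct Rle_dec; try lra; try nra.

(** The clamp is nondecreasing between consecutive half-integers, and the pieces join there because
    [2 rho k + rho = 2 rho (k + 1) - rho]. *)
Lemma hit_len_mono (rho x y : R) :
  0 <= rho <= / 2 -> x <= y -> hit_len rho x <= hit_len rho y.
Proof.
  intros Hr Hxy. unfold hit_len.
  assert (Hf : floor (x + / 2) <= floor (y + / 2)) by (apply floor_le; lra).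
  destruct (Rlt_le_dec (floor (x + / 2)) (floor (y + / 2))) as [Hlt|Hge].
  - assert (floor (x + / 2) + 1 <= floor (y + / 2)).
    { unfold floor in *. rewrite <- plus_IZR. apply IZR_le. apply lt_IZR in Hlt. lia. }
    clamp.
  - assert (E : floor (x + / 2) = floor (y + / 2)) by lra. rewrite E. clamp.
Qed.

Lemma hit_len_near (rho y : R) (z : Z) :
  rho < / 2 -> Rabs (y - IZR z) <= rho -> hit_len rho y = 2 * rho * IZR z + (y - IZR z).
Proof.
  intros Hr Hy. assert (E : floor (y + / 2) = IZR z).
  { pose proof (floor_bounds (y + / 2)) as Hb. unfold floor in *.
    unfold Rabs in Hy; destruct Rcase_abs in Hy;
    apply Rle_antisym; apply IZR_le_of_lt; lra. }
  unfold hit_len. rewrite E.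
  unfold Rabs in Hy; destruct Rcase_abs in Hy; clamp.
Qed.

(** At every point, enlarging [rho] by [tau] changes [hit_len] by the linear function [2 tau t] up
    to an error [tau]; the errors at the two ends give the [+ 1]. *)
Lemma hit_len_thicken (rho tau x y : R) :
  0 <= rho -> 0 <= tau ->
  hit_len (rho + tau) y - hit_len (rho + tau) x
    <= hit_len rho y - hit_len rho x + 2 * tau * (y - x + 1).
Proof.
  intros Hr Ht.
  assert (A : forall t, - tau <= hit_len (rho + tau) t - hit_len rho t - 2 * tau * t <= tau).
  { intros t. unfold hit_len. pose proof (floor_bounds (t + / 2)) as Hb.
    set (k := floor (t + / 2)) in *. clearbody k.
    assert (- tau <= 2 * tau * (t - k) <= tau) by nra.
    assert (2 * (rho + tau) * k - 2 * rho * k - 2 * tau * t = - (2 * tau * (t - k))) by ring.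
    destruct (Rle_lt_dec k t).
    - assert (0 <= 2 * tau * (t - k)) by nra. clamp.
    - assert (2 * tau * (t - k) <= 0) by nra. clamp. }
  pose proof (A x). pose proof (A y). lra.
Qed.

Lemma hit_len_diff_le (rho x y : R) :
  0 <= rho -> hit_len rho y - hit_len rho x <= 2 * rho * (y - x + 1).
Proof.
  intros Hr. pose proof (hit_len_thicken 0 rho x y (Rle_refl 0) Hr) as H.
  assert (A : forall t, hit_len 0 t = 0) by (intros t; unfold hit_len; clamp).
  rewrite !A, Rplus_0_l in H. lra.
Qed.

(** Only integers in [(x - rho, y + rho]] contribute, each at most [2 rho]. Unlike
    [hit_len_diff_le], the bound vanishes when no integer is crossed, which the small exponents
    require. *)
Lemma hit_len_diff_le_floor (rho x y : R) :
  0 <= rho <= / 2 ->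
  hit_len rho y - hit_len rho x <= 2 * rho * (floor (y + rho) - floor (x - rho)).
Proof.
  intros Hr.
  assert (A : hit_len rho y <= 2 * rho * floor (y + rho) + rho).
  { unfold hit_len. pose proof (floor_bounds (y + / 2)) as Hb.
    pose proof (floor_ge (y + rho) (Int_part (y + / 2))) as H1.
    pose proof (floor_ge (y + rho) (Int_part (y + / 2) - 1)) as H2.
    rewrite minus_IZR in H2. change (IZR (Int_part (y + / 2))) with (floor (y + / 2)) in *.
    set (k := floor (y + / 2)) in *. clearbody k.
    destruct (Rle_lt_dec k (y + rho)) as [H|H].
    - specialize (H1 H).
      assert (2 * rho * k <= 2 * rho * floor (y + rho)) by nra. clamp.
    - assert (k - 1 <= floor (y + rho)) as H3 by (apply H2; lra).
      assert (2 * rho * (k - 1) <= 2 * rho * floor (y + rho)) by nra. clamp. }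
  assert (B : 2 * rho * floor (x - rho) + rho <= hit_len rho x).
  { unfold hit_len. pose proof (floor_bounds (x + / 2)) as Hb.
    pose proof (floor_bounds (x - rho)) as Hc.
    assert (H1 : floor (x - rho) <= floor (x + / 2)) by (apply floor_le; lra).
    assert (H2 : x - rho < floor (x + / 2) -> floor (x - rho) <= floor (x + / 2) - 1).
    { intros H. unfold floor in *. rewrite <- minus_IZR. apply IZR_le_of_lt.
      rewrite minus_IZR. lra. }
    set (k := floor (x + / 2)) in *. clearbody k.
    destruct (Rle_lt_dec k (x - rho)) as [H|H].
    - assert (2 * rho * floor (x - rho) <= 2 * rho * k) by nra. clamp.
    - specialize (H2 H).
      assert (2 * rho * floor (x - rho) <= 2 * rho * (k - 1)) by nra. clamp. }
  lra.
Qed.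

(** * Growth and distortion of the maps [x -> xi (1 + x)^(m+1)] *)

Lemma pow_diff_bounds (a b : R) (m : nat) :
  0 <= a <= b ->
  INR (S m) * a ^ m * (b - a) <= b ^ S m - a ^ S m <= INR (S m) * b ^ m * (b - a).
Proof.
  intros Hab. induction m as [|m IH]; [simpl; lra|].
  assert (H1 : 0 <= a ^ S m) by (apply pow_le; lra).
  assert (H2 : a ^ S m <= b ^ S m) by (apply pow_incr; lra).
  replace (b ^ S (S m) - a ^ S (S m)) with (b * (b ^ S m - a ^ S m) + a ^ S m * (b - a))
    by (simpl; ring).
  rewrite (S_INR (S m)). set (c := INR (S m)) in *.
  replace ((c + 1) * a ^ S m * (b - a)) with (a * (c * a ^ m * (b - a)) + a ^ S m * (b - a))
    by (simpl; ring).
  replace ((c + 1) * b ^ S m * (b - a)) with (b * (c * b ^ m * (b - a)) + b ^ S m * (b - a))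
    by (simpl; ring).
  split; nra.
Qed.

Lemma exp_le_compat (x y : R) : x <= y -> exp x <= exp y.
Proof. intros [H|H]; [left; now apply exp_increasing|rewrite H; lra]. Qed.

Lemma pow_1p_le_exp (t : R) (m : nat) : 0 <= t -> (1 + t) ^ m <= exp (INR m * t).
Proof.
  intros Ht. induction m as [|m IH]; [simpl; rewrite Rmult_0_l, exp_0; lra|].
  rewrite S_INR, Rmult_plus_distr_r, Rmult_1_l, exp_plus. simpl.
  rewrite (Rmult_comm (exp _)). apply Rmult_le_compat; [lra|apply pow_le; lra| |exact IH].
  apply exp_ineq1_le.
Qed.

(* The index is shifted: [orbit xi m] is the power [m + 1], and [slope xi m] its derivative. *)
Definition orbit (xi : R) (m : nat) (x : R) : R := xi * (1 + x) ^ S m.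
Definition slope (xi : R) (m : nat) (x : R) : R := xi * INR (S m) * (1 + x) ^ m.

Lemma INR_S_pos (m : nat) : 0 < INR (S m).
Proof. apply lt_0_INR; lia. Qed.

Lemma slope_ge (xi x : R) (m : nat) : 0 < xi -> 0 <= x -> xi * INR (S m) <= slope xi m x.
Proof.
  intros Hxi Hx. unfold slope. pose proof (INR_S_pos m).
  assert (1 <= (1 + x) ^ m) by (apply pow_R1_Rle; lra).
  assert (0 < xi * INR (S m)) by nra. nra.
Qed.

Lemma slope_pos (xi x : R) (m : nat) : 0 < xi -> 0 <= x -> 0 < slope xi m x.
Proof.
  intros Hxi Hx. pose proof (slope_ge xi x m Hxi Hx). pose proof (INR_S_pos m). nra.
Qed.

Lemma slope_mono (xi x y : R) (m : nat) :
  0 < xi -> 0 <= x <= y -> slope xi m x <= slope xi m y.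
Proof.
  intros Hxi Hx. unfold slope. pose proof (INR_S_pos m).
  assert (0 < xi * INR (S m)) by nra.
  apply Rmult_le_compat_l; [lra|]. apply pow_incr. lra.
Qed.

Lemma slope_add_ge (xi x : R) (m p : nat) :
  0 < xi -> 0 <= x -> slope xi m x * (1 + x) ^ p <= slope xi (m + p) x.
Proof.
  intros Hxi Hx. unfold slope. rewrite pow_add.
  assert (INR (S m) <= INR (S (m + p))) by (apply le_INR; lia).
  assert (0 <= (1 + x) ^ m) by (apply pow_le; lra).
  assert (0 <= (1 + x) ^ p) by (apply pow_le; lra).
  assert (0 <= xi * ((1 + x) ^ m * (1 + x) ^ p)) by (repeat apply Rmult_le_pos; lra).
  nra.
Qed.

Lemma slope_index_mono (xi x : R) (m n : nat) :
  0 < xi -> 0 <= x -> (m <= n)%nat -> slope xi m x <= slope xi n x.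
Proof.
  intros Hxi Hx Hmn. replace n with (m + (n - m))%nat by lia.
  pose proof (slope_add_ge xi x m (n - m) Hxi Hx).
  assert (1 <= (1 + x) ^ (n - m)) by (apply pow_R1_Rle; lra).
  pose proof (slope_pos xi x m Hxi Hx). nra.
Qed.

(** Since [1 + v <= (1 + u)(1 + (v - u))], the powers differ by a factor at most
    [exp (m (v - u)) <= exp 1 <= 3]. *)
Lemma slope_distortion (xi u v : R) (m : nat) :
  0 < xi -> 0 <= u <= v -> INR m * (v - u) <= 1 -> slope xi m v <= 3 * slope xi m u.
Proof.
  intros Hxi Huv Hm. unfold slope.
  assert (H : (1 + v) ^ m <= 3 * (1 + u) ^ m).
  { apply Rle_trans with (((1 + u) * (1 + (v - u))) ^ m); [apply pow_incr; nra|].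
    rewrite Rpow_mult_distr.
    assert ((1 + (v - u)) ^ m <= 3).
    { eapply Rle_trans; [apply pow_1p_le_exp; lra|].
      eapply Rle_trans; [|apply exp_le_3].
      now apply exp_le_compat. }
    assert (0 <= (1 + u) ^ m) by (apply pow_le; lra). nra. }
  pose proof (INR_S_pos m). assert (0 < xi * INR (S m)) by nra. nra.
Qed.

Lemma orbit_diff_bounds (xi x y : R) (m : nat) :
  0 < xi -> 0 <= x <= y ->
  slope xi m x * (y - x) <= orbit xi m y - orbit xi m x <= slope xi m y * (y - x).
Proof.
  intros Hxi Hxy. unfold slope, orbit.
  pose proof (pow_diff_bounds (1 + x) (1 + y) m) as H.
  replace (1 + y - (1 + x)) with (y - x) in H by ring. nra.
Qed.

Lemma orbit_mono (xi x y : R) (m : nat) :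
  0 < xi -> 0 <= x <= y -> orbit xi m x <= orbit xi m y.
Proof.
  intros Hxi Hxy. pose proof (orbit_diff_bounds xi x y m Hxi Hxy).
  assert (0 < slope xi m x) by (apply slope_pos; lra). nra.
Qed.

(** * Hit sets pulled back to the parameter interval *)

Definition hits (rho xi : R) (eta : nat -> R) (m : nat) (x : R) : R :=
  hit_len rho (orbit xi m x + eta m).

Lemma hits_mono (rho xi : R) (eta : nat -> R) (m : nat) (x y : R) :
  0 <= rho <= / 2 -> 0 < xi -> 0 <= x <= y -> hits rho xi eta m x <= hits rho xi eta m y.
Proof.
  intros Hr Hxi Hxy. apply hit_len_mono; [exact Hr|].
  pose proof (orbit_mono xi x y m Hxi Hxy). lra.
Qed.

Lemma hits_thicken (rho tau xi : R) (eta : nat -> R) (m : nat) (x y : R) :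
  0 <= rho -> 0 <= tau ->
  hits (rho + tau) xi eta m y - hits (rho + tau) xi eta m x
    <= hits rho xi eta m y - hits rho xi eta m x
       + 2 * tau * (orbit xi m y - orbit xi m x + 1).
Proof.
  intros Hr Ht.
  pose proof (hit_len_thicken rho tau (orbit xi m x + eta m) (orbit xi m y + eta m) Hr Ht).
  unfold hits. lra.
Qed.

(* An interval of length [l] meeting the hit set lies in the hit set thickened by the
   oscillation of the orbit map on it. *)
Lemma hits_thick_full (rho d l xi : R) (eta : nat -> R) (m : nat) (a x : R) :
  0 < xi -> 0 < d -> 0 <= a -> rho + 3 * d * l < / 2 ->
  d <= slope xi m a -> slope xi m (a + l) <= 3 * d ->
  a <= x <= a + l ->
  hits (rho + 3 * d * l) xi eta m (a + l) - hits (rho + 3 * d * l) xi eta m a < d * l ->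
  far rho (orbit xi m x + eta m).
Proof.
  intros Hxi Hd Ha Hr H1 H2 Hx H z. apply Rnot_lt_le; intros Hz.
  assert (A : forall y, a <= y <= a + l -> Rabs (orbit xi m y + eta m - IZR z) <= rho + 3 * d * l).
  { intros y Hy.
    assert (Ho : orbit xi m (a + l) - orbit xi m a <= 3 * d * l).
    { pose proof (orbit_diff_bounds xi a (a + l) m Hxi).
      assert (0 <= l) by lra. nra. }
    pose proof (orbit_mono xi a y m Hxi). pose proof (orbit_mono xi y (a + l) m Hxi).
    pose proof (orbit_mono xi a x m Hxi). pose proof (orbit_mono xi x (a + l) m Hxi).
    apply Rabs_def2 in Hz. apply Rabs_le. lra. }
  pose proof (orbit_diff_bounds xi a (a + l) m Hxi) as Ho.
  unfold hits in H.
  rewrite (hit_len_near _ _ z Hr (A a ltac:(lra))),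
    (hit_len_near _ _ z Hr (A (a + l) ltac:(lra))) in H.
  assert (0 <= l) by lra. nra.
Qed.

(** Division by the slope turns hit length in the image into excluded parameter length. The density
    is [2 rho] up to the distortion factor [3]; the term [/ slope] pays for one extra integer at the
    boundary. *)
Lemma hits_over_slope_le (rho xi : R) (eta : nat -> R) (m : nat) (u v : R) :
  0 < xi -> 0 <= rho -> 0 <= u <= v -> INR m * (v - u) <= 1 ->
  (hits rho xi eta m v - hits rho xi eta m u) / slope xi m u
    <= 2 * rho * (3 * (v - u) + / slope xi m u).
Proof.
  intros Hxi Hr Huv Hm.
  pose proof (slope_pos xi u m Hxi ltac:(lra)) as Hs.
  pose proof (slope_distortion xi u v m Hxi Huv Hm) as Hd.
  pose proof (orbit_diff_bounds xi u v m Hxi Huv) as Ho.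
  pose proof (hit_len_diff_le rho (orbit xi m u + eta m) (orbit xi m v + eta m) Hr) as Hh.
  fold (hits rho xi eta m u) (hits rho xi eta m v) in Hh.
  set (s := slope xi m u) in *.
  replace (2 * rho * (3 * (v - u) + / s)) with (2 * rho * (3 * s * (v - u) + 1) / s)
    by (field; lra).
  apply Rmult_le_compat_r; [left; now apply Rinv_0_lt_compat|].
  eapply Rle_trans; [exact Hh|]. apply Rmult_le_compat_l; [lra|].
  assert (slope xi m v * (v - u) <= 3 * s * (v - u)) by nra. lra.
Qed.

(** * The inductive step from one block of exponents to the next *)

Lemma nat_ceil (x : R) : 0 <= x -> exists n : nat, x <= INR n <= x + 1.
Proof.
  intros Hx. destruct (archimed x) as [H1 H2]. exists (Z.to_nat (up x)).
  assert (0 <= up x)%Z by (apply le_IZR; lra).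
  rewrite INR_IZR_INZ, Z2Nat.id by easy. lra.
Qed.

(* The indices are cut into blocks of length [h]. On [u, v] the indices before block [k] are
   settled, and block [k] still excludes at most half of the interval, its hit sets being
   measured with the approximate slopes [d]. *)
Definition stage (xi : R) (eta : nat -> R) (h : nat) (rho e : R) (k : nat) (u v : R) : Prop :=
  e <= u /\ u < v /\ v <= 2 * e /\
  1 <= (v - u) * slope xi (S k * h) u /\
  INR (S (S k) * h) * (v - u) <= 1 /\
  (exists d : nat -> R,
     (forall i, (i < h)%nat ->
        0 < d i /\ d i <= slope xi (k * h + i) u /\ slope xi (k * h + i) v <= 3 * d i) /\
     psum (fun i => (hits rho xi eta (k * h + i) v - hits rho xi eta (k * h + i) u) / d i) h
       <= (v - u) / 2) /\
  (forall m x, (m < k * h)%nat -> u <= x <= v -> far rho (orbit xi m x + eta m)).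

Lemma stage_succ (xi : R) (eta : nat -> R) (h : nat) (rho e : R) (k : nat) (u v : R) :
  0 < xi -> 0 < e -> (1 <= h)%nat -> rho = / (64 * INR h) -> 384 * INR h <= (1 + e) ^ h ->
  stage xi eta h rho e k u v ->
  exists u' v', u <= u' /\ v' <= v /\ stage xi eta h rho e (S k) u' v'.
Proof.
  intros Hxi He Hh Hrho Hgrow (Heu & Huv & Hve & Hexp & Hdist & (d & Hd & Hpend) & Hgood).
  assert (Hh1 : 1 <= INR h) by (apply (le_INR 1); lia).
  assert (Hrho0 : 0 < rho) by (subst; apply Rinv_0_lt_compat; lra).
  assert (Hrhoh : INR h * rho = / 64) by (subst; field; lra).
  assert (Hrho1 : rho <= / 64) by nra.
  set (l := v - u) in *. set (D := slope xi (S k * h) u) in *.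
  assert (Hl : 0 < l) by (unfold l; lra).
  assert (HD : 0 < D) by (apply slope_pos; lra).
  (* The pieces have length [l'] with [h D l'] between [1/384] and [1/192]: short enough that
     thickening is cheap, long enough that one block of growth restores the stretching. *)
  destruct (nat_ceil (192 * INR h * D * l)) as (N & HN1 & HN2); [nra|].
  assert (HNbig : 192 <= 192 * INR h * D * l).
  { assert (1 <= INR h * (l * D)) by nra. lra. }
  assert (HN0 : 0 < INR N) by lra.
  set (l' := l / INR N).
  assert (El : INR N * l' = l) by (unfold l'; field; lra).
  assert (Hl' : 0 < l') by (unfold l'; apply Rdiv_lt_0_compat; lra).
  assert (Hl'up : 192 * INR h * D * l' <= 1).
  { apply Rmult_le_reg_r with l; [easy|].
    apply Rle_trans with (INR N * l'); [|lra].
    replace (192 * INR h * D * l' * l) with (192 * INR h * D * l * l') by ring. nra. }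
  assert (Hl'lo : 1 <= 384 * INR h * D * l').
  { apply Rmult_le_reg_r with l; [easy|].
    apply Rle_trans with (INR N * l'); [lra|].
    replace (384 * INR h * D * l' * l) with (2 * (192 * INR h * D * l) * l') by ring.
    apply Rmult_le_compat_r; lra. }
  assert (Hl'2 : l' <= l / 2) by nra.
  clearbody l'.
  assert (HdD : forall i, (i < h)%nat -> d i <= D).
  { intros i Hi. destruct (Hd i Hi) as (_ & H & _). eapply Rle_trans; [exact H|].
    apply slope_index_mono; [easy|lra|]. simpl. lia. }
  assert (Hthick : forall i, (i < h)%nat -> rho + 3 * d i * l' < / 2).
  { intros i Hi. pose proof (HdD i Hi). assert (d i * l' <= D * l') by nra.
    assert (D * l' <= INR h * (D * l')) by (assert (0 < D * l') by nra; nra). lra. }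
  (* [F1] measures the current block, thickened by the oscillation of its maps on a piece; [F2]
     measures the next block, with the slopes at [u] that become its new [d]. *)
  set (F1 := fun x => psum (fun i => hits (rho + 3 * d i * l') xi eta (k * h + i) x / d i) h).
  set (F2 := fun x =>
    psum (fun i => hits rho xi eta (S k * h + i) x / slope xi (S k * h + i) u) h).
  assert (HF1 : F1 v - F1 u <= l / 2 + l / 8).
  { unfold F1. rewrite <- psum_minus.
    eapply Rle_trans with (psum (fun i =>
      (hits rho xi eta (k * h + i) v - hits rho xi eta (k * h + i) u) / d i
       + 6 * l' * (3 * D * l + 1)) h).
    - apply psum_le. intros i Hi. destruct (Hd i Hi) as (Hd0 & Hd1 & Hd2).
      pose proof (HdD i Hi) as Hd3.
      pose proof (hits_thicken rho (3 * d i * l') xi eta (k * h + i) u v ltac:(lra)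
                    ltac:(repeat apply Rmult_le_pos; lra)) as HT.
      pose proof (orbit_diff_bounds xi u v (k * h + i) Hxi ltac:(lra)) as Ho.
      apply Rmult_le_reg_r with (d i); [easy|].
      match goal with |- (?a / _ - ?b / _) * _ <= (?c / _ + ?t) * _ =>
        replace ((a / d i - b / d i) * d i) with (a - b) by (field; lra);
        replace ((c / d i + t) * d i) with (c + t * d i) by (field; lra) end.
      eapply Rle_trans; [exact HT|]. apply Rplus_le_compat_l.
      replace (6 * l' * (3 * D * l + 1) * d i) with (2 * (3 * d i * l') * (3 * D * l + 1)) by ring.
      apply Rmult_le_compat_l; [repeat apply Rmult_le_pos; lra|].
      fold l in Ho. assert (slope xi (k * h + i) v * l <= 3 * D * l) by nra. lra.
    - rewrite psum_plus, psum_const.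
      (* The total cost of thickening: [l D >= 1] absorbs the constant term, and [192 h D l' <= 1]
         gives [24 h D l' l <= l / 8]. *)
      assert (INR h * (6 * l' * (3 * D * l + 1)) <= l / 8); [|lra].
      apply Rle_trans with (24 * INR h * D * l' * l); [|nra].
      assert (0 < INR h * l') by nra.
      replace (24 * INR h * D * l' * l) with (INR h * l' * (24 * (l * D))) by ring.
      replace (INR h * (6 * l' * (3 * D * l + 1)))
        with (INR h * l' * (18 * (l * D) + 6)) by ring.
      apply Rmult_le_compat_l; lra. }
  assert (HF2 : F2 v - F2 u <= l / 8).
  { unfold F2. rewrite <- psum_minus.
    (* Each index costs [2 rho (3 l + / D)] at most, with [/ D <= l]; then [h rho = 1/64]. *)
    apply Rle_trans with (INR h * (2 * rho * (4 * l))); [|nra].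
    apply psum_bound. intros i Hi.
    assert (Hm : INR (S k * h + i) * (v - u) <= 1).
    { fold l. eapply Rle_trans; [|exact Hdist]. apply Rmult_le_compat_r; [lra|].
      apply le_INR. simpl. lia. }
    pose proof (hits_over_slope_le rho xi eta (S k * h + i) u v Hxi ltac:(lra) ltac:(lra) Hm)
      as HH.
    unfold Rdiv in *. rewrite Rmult_minus_distr_r in HH.
    eapply Rle_trans; [exact HH|]. fold l.
    assert (/ slope xi (S k * h + i) u <= l); [|nra].
    assert (HDm : D <= slope xi (S k * h + i) u) by (apply slope_index_mono; [easy|lra|lia]).
    apply Rle_trans with (/ D); [now apply Rinv_le_contravar|].
    apply Rmult_le_reg_r with D; [easy|]. rewrite Rinv_l by lra. exact Hexp. }
  (* The total is at most [5/8 l + 2/8 l < l], so some piece has [F1 + 2 F2] increasing by less than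
     [l']: the part [F1 < l'] frees it of the current block, and the weight [2] leaves the next
     block at most half of it. *)
  destruct (interval_pigeonhole (fun x => F1 x + 2 * F2 x) u l' l' N) as (j & Hj & HF).
  { rewrite El. replace (u + l) with v by (unfold l; ring). lra. }
  set (a := u + INR j * l') in *.
  assert (Hjl : 0 <= INR j * l') by (apply Rmult_le_pos; [apply pos_INR|lra]).
  assert (Hjl2 : INR j * l' + l' <= l).
  { rewrite <- El. assert (INR j + 1 <= INR N) by (rewrite <- S_INR; apply le_INR; lia). nra. }
  assert (Ha : u <= a) by (unfold a; lra).
  assert (Hb : a + l' <= v) by (unfold a, l in *; lra).
  assert (M1 : forall i, (i < h)%nat ->
    0 <= hits (rho + 3 * d i * l') xi eta (k * h + i) (a + l') / d i
         - hits (rho + 3 * d i * l') xi eta (k * h + i) a / d i).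
  { intros i Hi. destruct (Hd i Hi) as (Hd0 & _ & _). pose proof (Hthick i Hi).
    assert (0 < d i * l') by nra.
    pose proof (hits_mono (rho + 3 * d i * l') xi eta (k * h + i) a (a + l')
                  ltac:(lra) Hxi ltac:(lra)).
    unfold Rdiv. rewrite <- Rmult_minus_distr_r.
    apply Rmult_le_pos; [lra|left; now apply Rinv_0_lt_compat]. }
  assert (M2 : 0 <= F2 (a + l') - F2 a).
  { unfold F2. rewrite <- psum_minus. apply psum_ge0. intros i Hi.
    pose proof (slope_pos xi u (S k * h + i) Hxi ltac:(lra)).
    pose proof (hits_mono rho xi eta (S k * h + i) a (a + l') ltac:(lra) Hxi ltac:(lra)).
    unfold Rdiv. rewrite <- Rmult_minus_distr_r.
    apply Rmult_le_pos; [lra|left; now apply Rinv_0_lt_compat]. }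
  assert (M1' : 0 <= F1 (a + l') - F1 a)
    by (unfold F1; rewrite <- psum_minus; now apply psum_ge0).
  exists a, (a + l'). split; [lra|]. split; [lra|].
  unfold stage. replace (a + l' - a) with l' by ring.
  split; [lra|]. split; [lra|]. split; [lra|]. split; [|split; [|split]].
  (* Over one block the slope gains [(1 + e)^h >= 384 h], matching [384 h D l' >= 1]. *)
  - pose proof (slope_add_ge xi u (S k * h) h Hxi ltac:(lra)) as HS. fold D in HS.
    replace (S k * h + h)%nat with (S (S k) * h)%nat in HS by (simpl; lia).
    pose proof (slope_mono xi u a (S (S k) * h) Hxi ltac:(lra)) as HS'.
    assert ((1 + e) ^ h <= (1 + u) ^ h) by (apply pow_incr; lra).
    assert (D * (384 * INR h) <= D * (1 + u) ^ h) by (apply Rmult_le_compat_l; lra).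
    assert (l' * (D * (384 * INR h)) <= l' * slope xi (S (S k) * h) a)
      by (apply Rmult_le_compat_l; lra).
    lra.
  (* Halving the length compensates for the larger index, since [k + 3 <= 2 (k + 2)]. *)
  - rewrite mult_INR in Hdist |- *. rewrite (S_INR (S (S k))).
    assert (H1 : 1 <= INR (S (S k))) by (apply (le_INR 1); lia).
    assert (0 < INR h * l') by nra.
    assert (INR (S (S k)) * INR h * l' <= INR (S (S k)) * INR h * (l / 2))
      by (apply Rmult_le_compat_l; [nra|lra]).
    replace ((INR (S (S k)) + 1) * INR h * l')
      with (INR (S (S k)) * INR h * l' + 1 * (INR h * l')) by ring.
    assert (1 * (INR h * l') <= INR (S (S k)) * (INR h * l')) by (apply Rmult_le_compat_r; lra).
    lra.
  - exists (fun i => slope xi (S k * h + i) u). split.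
    + intros i Hi. split; [apply slope_pos; lra|]. split; [apply slope_mono; lra|].
      apply slope_distortion; [lra|lra|].
      apply Rle_trans with (INR (S (S k) * h) * l); [|exact Hdist].
      apply Rmult_le_compat; [apply pos_INR|lra|apply le_INR; simpl; lia|unfold l; lra].
    + assert (F2 (a + l') - F2 a <= l' / 2) by lra.
      eapply Rle_trans; [|eassumption]. unfold F2. rewrite <- psum_minus.
      apply psum_le. intros i Hi. unfold Rdiv. rewrite Rmult_minus_distr_r. lra.
  - intros m x Hm Hx. destruct (Nat.lt_ge_cases m (k * h)) as [Hlt|Hge].
    + apply Hgood; [easy|lra].
    + assert (exists i, (i < h)%nat /\ m = (k * h + i)%nat) as (i & Hi & ->).
      { exists (m - k * h)%nat. simpl in Hm. lia. }
      destruct (Hd i Hi) as (Hd0 & Hd1 & Hd2).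
      pose proof (slope_mono xi u a (k * h + i) Hxi ltac:(lra)).
      pose proof (slope_mono xi (a + l') v (k * h + i) Hxi ltac:(lra)).
      apply (hits_thick_full rho (d i) l' xi eta (k * h + i) a x);
        try lra; [now apply Hthick|].
      (* All terms of the sum are nonnegative, so each is below [l']; a piece meeting the hit set
         would contribute at least [l']. *)
      assert (HT : F1 (a + l') - F1 a < l') by lra.
      unfold F1 in HT. rewrite <- psum_minus in HT.
      pose proof (psum_term_le _ h i M1 Hi) as HTi. simpl in HTi.
      apply Rmult_lt_reg_r with (/ d i); [now apply Rinv_0_lt_compat|].
      replace (d i * l' * / d i) with l' by (field; lra).
      rewrite Rmult_minus_distr_r. unfold Rdiv in *. lra.
Qed.

(** * Passage to the limit along nested intervals *)

Lemma nested_choice (P : nat -> R -> R -> Prop) (u0 v0 : R) :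
  (forall k u v, P k u v -> u <= v) ->
  (forall k u v, P k u v -> exists u' v', u <= u' /\ v' <= v /\ P (S k) u' v') ->
  P 0%nat u0 v0 ->
  exists x, forall k, exists u v, P k u v /\ u <= x <= v.
Proof.
  intros Hle Hstep H0.
  (* Carrying the level inside the state makes the choice of a successor a function on a single
     type, which can be iterated. *)
  set (T := {s : nat * R * R | P (fst (fst s)) (snd (fst s)) (snd s)}).
  assert (next : forall s : T, {s' : T |
    fst (fst (proj1_sig s')) = S (fst (fst (proj1_sig s))) /\
    snd (fst (proj1_sig s)) <= snd (fst (proj1_sig s')) /\
    snd (proj1_sig s') <= snd (proj1_sig s)}).
  { intros [[[k u] v] Hs]. apply constructive_indefinite_description. simpl in *.
    destruct (Hstep k u v Hs) as (u' & v' & Hu & Hv & Hs').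
    exists (exist (fun s => P (fst (fst s)) (snd (fst s)) (snd s)) (S k, u', v') Hs').
    simpl. auto. }
  pose (s := fix s n : T := match n with
    | O => exist (fun s => P (fst (fst s)) (snd (fst s)) (snd s)) (0%nat, u0, v0) H0
    | S p => proj1_sig (next (s p)) end).
  pose (U := fun n => snd (fst (proj1_sig (s n)))). pose (V := fun n => snd (proj1_sig (s n))).
  assert (HU : forall n, U n <= U (S n)) by (intros n; apply (proj2_sig (next (s n)))).
  assert (HV : forall n, V (S n) <= V n) by (intros n; apply (proj2_sig (next (s n)))).
  assert (Hk : forall n, fst (fst (proj1_sig (s n))) = n).
  { induction n as [|n IH]; [reflexivity|].
    rewrite <- IH at 2. apply (proj2_sig (next (s n))). }
  assert (HP : forall n, P n (U n) (V n)).
  { intros n. rewrite <- (Hk n) at 1. exact (proj2_sig (s n)). }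
  assert (HU' : forall n p, U n <= U (n + p)%nat).
  { induction p as [|p IH]; [rewrite Nat.add_0_r; lra|].
    rewrite Nat.add_succ_r. pose proof (HU (n + p)%nat). lra. }
  assert (HV' : forall n p, V (n + p)%nat <= V n).
  { induction p as [|p IH]; [rewrite Nat.add_0_r; lra|].
    rewrite Nat.add_succ_r. pose proof (HV (n + p)%nat). lra. }
  assert (HUV : forall n p, U n <= V p).
  { intros n p. pose proof (HU' n p). pose proof (HV' p n) as HVn.
    rewrite Nat.add_comm in HVn. pose proof (Hle _ _ _ (HP (n + p)%nat)). lra. }
  destruct (completeness (fun y => exists n, y = U n)) as (x & Hx1 & Hx2).
  - exists (V 0%nat). intros y (n & ->). apply HUV.
  - exists (U 0%nat). now exists 0%nat.
  - exists x. intros k. exists (U k), (V k). split; [apply HP|]. split.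
    + apply Hx1. now exists k.
    + apply Hx2. intros y (n & ->). apply HUV.
Qed.

Lemma stage_limit (xi : R) (eta : nat -> R) (h : nat) (rho e u v : R) :
  0 < xi -> 0 < e -> (1 <= h)%nat -> rho = / (64 * INR h) -> 384 * INR h <= (1 + e) ^ h ->
  stage xi eta h rho e 0 u v ->
  exists x, e <= x <= 2 * e /\ forall m, far rho (orbit xi m x + eta m).
Proof.
  intros Hxi He Hh Hrho Hgrow H0.
  destruct (nested_choice (stage xi eta h rho e) u v) as (x & Hx); [| |exact H0|].
  - intros k a b (_ & H & _). lra.
  - intros k a b. now apply stage_succ.
  - exists x. split.
    + destruct (Hx 0%nat) as (a & b & (H1 & _ & H2 & _) & H3). lra.
    (* Stage [S m] settles all indices below [(S m) h], which include [m] because [h >= 1]. *)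
    + intros m. destruct (Hx (S m)) as (a & b & (_ & _ & _ & _ & _ & _ & Hfar) & Hab).
      apply Hfar; [nia|exact Hab].
Qed.

(** * Averaging over dyadic scales *)

Lemma INR_pow2 (k : nat) : INR (2 ^ k) = 2 ^ k.
Proof. rewrite pow_INR. reflexivity. Qed.

Lemma pow2_pos (k : nat) : 0 < 2 ^ k.
Proof. apply pow_lt; lra. Qed.

(** Each dyadic block of the harmonic sum contributes at most [1]. *)
Lemma harmonic_pow2_le (k : nat) : psum (fun m => / INR (S m)) (2 ^ k) <= INR k + 1.
Proof.
  induction k as [|k IH]; [simpl; lra|].
  rewrite S_INR. replace (2 ^ S k)%nat with (2 ^ k + 2 ^ k)%nat by (simpl; lia).
  rewrite psum_split.
  assert (psum (fun i => / INR (S (2 ^ k + i))) (2 ^ k) <= INR (2 ^ k) * / INR (2 ^ k)).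
  { assert (0 < INR (2 ^ k)) by (rewrite INR_pow2; apply pow2_pos).
    apply psum_bound. intros i _. apply Rinv_le_contravar; [easy|apply le_INR; lia]. }
  rewrite Rinv_r in H by (rewrite INR_pow2; pose proof (pow2_pos k); lra). lra.
Qed.

(** Differences with lag [3] leave three terms at each end, which monotonicity compares with the
    extreme ones. *)
Lemma telescope3_le (c : nat -> R) (a n : nat) :
  (forall j, c (S j) <= c j) ->
  psum (fun t => c (a + t)%nat - c (a + t + 3)%nat) n <= 3 * (c a - c (a + n + 2)%nat).
Proof.
  intros Hc.
  assert (Hc2 : forall p, c (a + p)%nat <= c a).
  { induction p as [|p IH]; [rewrite Nat.add_0_r; lra|].
    rewrite Nat.add_succ_r. pose proof (Hc (a + p)%nat). lra. }
  assert (E : psum (fun t => c (a + t)%nat - c (a + t + 3)%nat) n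
    = c a + c (a + 1)%nat + c (a + 2)%nat
      - c (a + n)%nat - c (a + n + 1)%nat - c (a + n + 2)%nat).
  { induction n as [|n IH].
    - simpl. rewrite Nat.add_0_r. ring.
    - simpl psum. rewrite IH.
      replace (a + n + 3)%nat with (a + S n + 2)%nat by lia.
      replace (a + n + 2)%nat with (a + S n + 1)%nat by lia.
      replace (a + n + 1)%nat with (a + S n)%nat by lia. ring. }
  rewrite E. pose proof (Hc2 1%nat). pose proof (Hc2 2%nat).
  pose proof (Hc (a + n)%nat). pose proof (Hc (a + n + 1)%nat).
  replace (a + n + 2)%nat with (S (a + n + 1)) in * by lia.
  replace (a + n + 1)%nat with (S (a + n)) in * by lia. lra.
Qed.

(* The number of integers crossed by the [m]-th orbit map between scales [2^-j] and [2^-(j+3)]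
   telescopes over [j] and is bounded in total as long as [m 2^-j] is, so weighting it by
   [1 / m] and averaging over sufficiently many scales gives one with a bounded total. *)
Lemma scale_selection (xi : R) (eta : nat -> R) (s a : nat) :
  0 < xi ->
  exists j, (a <= j)%nat /\
    psum (fun m => (floor (orbit xi m (/ 2 ^ j) + eta m)
                    - floor (orbit xi m (/ 2 ^ (j + 3)) + eta m)) / INR (S m))
         (2 ^ (s + j + 2))
      <= 7 * (xi * exp (4 * 2 ^ s) + 1).
Proof.
  intros Hxi.
  (* The cap keeps [(m + 1) cut] at most [4 2^s], so the orbit stays in [[0, xi exp (4 2^s)]] at all
     scales and crosses at most [B] integers in total. *)
  pose (cut := fun m j => Rmin (/ 2 ^ j) (4 * 2 ^ s / INR (S m))).
  pose (c := fun m j => floor (orbit xi m (cut m j) + eta m)).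
  set (B := xi * exp (4 * 2 ^ s) + 1).
  assert (HB : 0 < B) by (unfold B; pose proof (exp_pos (4 * 2 ^ s)); nra).
  assert (Hcut0 : forall m j, 0 <= cut m j).
  { intros m j. apply Rmin_glb; [left; apply Rinv_0_lt_compat, pow2_pos|].
    apply Rmult_le_pos; [pose proof (pow2_pos s); lra|].
    left. apply Rinv_0_lt_compat, INR_S_pos. }
  assert (Hc : forall m j, c m (S j) <= c m j).
  { intros m j. apply floor_le. apply Rplus_le_compat_r. apply orbit_mono; [easy|].
    split; [apply Hcut0|]. apply Rle_min_compat_r.
    apply Rinv_le_contravar; [apply pow2_pos|]. simpl. pose proof (pow2_pos j). lra. }
  assert (Hc' : forall m j p, c m (j + p)%nat <= c m j).
  { intros m j p. induction p as [|p IH]; [rewrite Nat.add_0_r; lra|].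
    rewrite Nat.add_succ_r. pose proof (Hc m (j + p)%nat). lra. }
  assert (Hrange : forall m j p, c m j - c m p <= B).
  { intros m j p. unfold c.
    pose proof (floor_bounds (orbit xi m (cut m j) + eta m)).
    pose proof (floor_bounds (orbit xi m (cut m p) + eta m)).
    assert (0 <= orbit xi m (cut m p)).
    { unfold orbit. apply Rmult_le_pos; [lra|]. apply pow_le.
      pose proof (Hcut0 m p). lra. }
    assert (orbit xi m (cut m j) <= xi * exp (4 * 2 ^ s)); [|unfold B; lra].
    unfold orbit. apply Rmult_le_compat_l; [lra|].
    eapply Rle_trans; [apply pow_1p_le_exp, Hcut0|].
    apply exp_le_compat. pose proof (INR_S_pos m) as Hm.
    replace (4 * 2 ^ s) with (INR (S m) * (4 * 2 ^ s / INR (S m))) by (field; lra).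
    apply Rmult_le_compat_l; [lra|]. apply Rmin_r. }
  (* [N] covers the exponents of all [n] scales, and [n] makes the harmonic bound [s + a + n + 3]
     equal to [2 n], so the average over scales is at most [6 B < 7 B]. *)
  set (n := (s + a + 3)%nat). set (N := (2 ^ (s + a + n + 2))%nat).
  destruct (psum_pigeonhole
    (fun t => psum (fun m => (c m (a + t)%nat - c m (a + t + 3)%nat) / INR (S m)) N)
    n (7 * B)) as (t & Ht & Hsum).
  { assert (Hn : 0 < INR n) by (apply lt_0_INR; lia).
    apply Rle_lt_trans with (INR n * (6 * B)); [|apply Rmult_lt_compat_l; lra].
    rewrite psum_swap.
    apply Rle_trans with (psum (fun m => 3 * B * / INR (S m)) N).
    - apply psum_le. intros m _. unfold Rdiv.
      apply Rle_trans with
        (/ INR (S m) * psum (fun t => c m (a + t)%nat - c m (a + t + 3)%nat) n).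
      + rewrite <- psum_scal. apply psum_le. intros; lra.
      + rewrite Rmult_comm. apply Rmult_le_compat_r.
        * left. apply Rinv_0_lt_compat, INR_S_pos.
        * eapply Rle_trans; [now apply telescope3_le|].
          pose proof (Hrange m a (a + n + 2)%nat). lra.
    - rewrite psum_scal. pose proof (harmonic_pow2_le (s + a + n + 2)) as HH.
      fold N in HH.
      replace (INR n * (6 * B)) with (3 * B * (2 * INR n)) by ring.
      apply Rmult_le_compat_l; [lra|]. eapply Rle_trans; [exact HH|].
      unfold n. rewrite !plus_INR. simpl. lra. }
  exists (a + t)%nat. split; [lia|].
  apply Rle_trans with
    (psum (fun m => (c m (a + t)%nat - c m (a + t + 3)%nat) / INR (S m)) N); [|lra].
  assert (HN : (2 ^ (s + (a + t) + 2) <= N)%nat) by (apply Nat.pow_le_mono_r; lia).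
  eapply Rle_trans; [|apply psum_le_length; [exact HN|]].
  - apply psum_le. intros m Hm.
    (* For [m < 2^(s + a + t + 2)] the cap is inactive. *)
    assert (Hcut : forall p, cut m (a + t + p)%nat = / 2 ^ (a + t + p)).
    { intros p. apply Rmin_left.
      pose proof (INR_S_pos m) as HSm. pose proof (pow2_pos (a + t + p)) as H2.
      apply Rmult_le_reg_r with (INR (S m) * 2 ^ (a + t + p)); [nra|].
      replace (/ 2 ^ (a + t + p) * (INR (S m) * 2 ^ (a + t + p))) with (INR (S m))
        by (field; lra).
      replace (4 * 2 ^ s / INR (S m) * (INR (S m) * 2 ^ (a + t + p)))
        with (2 ^ (s + (a + t) + 2) * 2 ^ p) by (rewrite !pow_add; change (2 ^ 2) with (2 * (2 * 1)); field; lra).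
      rewrite <- pow_add, <- INR_pow2. apply le_INR.
      apply Nat.le_trans with (2 ^ (s + (a + t) + 2))%nat; [lia|].
      apply Nat.pow_le_mono_r; lia. }
    unfold c. rewrite (Hcut 3%nat).
    pose proof (Hcut 0%nat) as Hcut'. rewrite Nat.add_0_r in Hcut'. rewrite Hcut'. lra.
  - intros m _. unfold Rdiv. apply Rmult_le_pos.
    + pose proof (Hc' m (a + t)%nat 3%nat). lra.
    + left. apply Rinv_0_lt_compat, INR_S_pos.
Qed.

(** * Block length and the initial interval *)

Lemma geometric_sum_le (a : R) (n : nat) :
  0 < a -> psum (fun i => / (1 + a) ^ i) n <= (1 + a) / a.
Proof.
  intros Ha.
  assert (E : psum (fun i => / (1 + a) ^ i) n = (1 + a) / a * (1 - / (1 + a) ^ n)).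
  { induction n as [|n IH]; [simpl; field; lra|].
    simpl psum. rewrite IH. simpl. assert (0 < (1 + a) ^ n) by (apply pow_lt; lra).
    field. lra. }
  rewrite E. assert (0 < / (1 + a) ^ n) by (apply Rinv_0_lt_compat, pow_lt; lra).
  assert (0 < (1 + a) / a) by (apply Rdiv_lt_0_compat; lra). nra.
Qed.

(** This is [4 log_2 (1 / e) / e] for [e = 2^-i]. *)
Definition block_length (i : nat) : nat := (4 * i * 2 ^ i)%nat.

Lemma INR_block_length (i : nat) : INR (block_length i) = 4 * INR i * 2 ^ i.
Proof. unfold block_length. rewrite !mult_INR, INR_pow2. simpl. ring. Qed.

(** By Bernoulli [(1 + 2^-i)^(2^i) >= 2], so the power is at least [2^(4i) = 8^i 2^i], and
    [8^i >= 1536 i] from [i = 5] on. *)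
Lemma block_growth (i : nat) :
  (5 <= i)%nat -> 384 * INR (block_length i) <= (1 + / 2 ^ i) ^ block_length i.
Proof.
  intros Hi. assert (H8 : 1536 * INR i <= 8 ^ i).
  { induction Hi as [|i Hi IH]; [simpl; lra|].
    assert (1 <= INR i) by (apply (le_INR 1); lia).
    rewrite S_INR. simpl pow. lra. }
  rewrite INR_block_length. unfold block_length.
  rewrite (Nat.mul_comm (4 * i)), pow_mult.
  pose proof (pow2_pos i) as H2.
  assert (HB : 2 <= (1 + / 2 ^ i) ^ (2 ^ i)).
  { pose proof (poly (2 ^ i) (/ 2 ^ i) ltac:(now apply Rinv_0_lt_compat)) as H.
    rewrite INR_pow2, Rinv_r in H; lra. }
  apply Rle_trans with (2 ^ (4 * i)); [|apply pow_incr; lra].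
  replace (2 ^ (4 * i)) with (8 ^ i * 2 ^ i); [nra|].
  rewrite <- Rpow_mult_distr, pow_mult. f_equal. simpl. ring.
Qed.

Lemma exists_initial_stage (xi : R) (eta : nat -> R) (a : nat) :
  0 < xi ->
  exists i u v, (a <= i)%nat /\ (5 <= i)%nat /\
    stage xi eta (block_length i) (/ (64 * INR (block_length i))) (/ 2 ^ i) 0 u v.
Proof.
  intros Hxi.
  assert (exists s, 2 / xi <= 2 ^ s) as (s & Hs).
  { destruct (Pow_x_infinity 2 ltac:(rewrite Rabs_right; lra) (2 / xi)) as (s & Hs).
    exists s. specialize (Hs s (Nat.le_refl s)).
    rewrite Rabs_right in Hs by (pose proof (pow2_pos s); lra). lra. }
  set (C := 7 * (xi * exp (4 * 2 ^ s) + 1)).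
  assert (HC : 0 < C) by (unfold C; pose proof (exp_pos (4 * 2 ^ s)); nra).
  (* A scale beyond [b] has [i] at least [2^s], [1 / xi] and [C / xi], which absorbs all constants
     depending on [xi]. *)
  destruct (nat_ceil (2 ^ s + / xi + C / xi)) as (b & Hb & _).
  { assert (0 < / xi) by now apply Rinv_0_lt_compat.
    assert (0 < C / xi) by now apply Rdiv_lt_0_compat. pose proof (pow2_pos s). lra. }
  destruct (scale_selection xi eta s (a + b + 5) Hxi) as (j & Hj & HW). fold C in HW.
  (* With this shift [[e, 2e]] lies inside [[e/2, 4e]], the range controlled by the selected scale
     [j]. *)
  set (i := (j + 2)%nat).
  assert (Hi1 : 1 <= INR i) by (apply (le_INR 1); unfold i; lia).
  assert (Hbi : INR b <= INR i) by (apply le_INR; unfold i; lia).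
  assert (Hixi : 1 <= xi * INR i).
  { assert (xi * / xi <= xi * INR i); [|rewrite Rinv_r in *; lra].
    apply Rmult_le_compat_l; [lra|]. pose proof (pow2_pos s).
    assert (0 < C / xi) by now apply Rdiv_lt_0_compat. lra. }
  assert (HiC : C <= xi * INR i).
  { replace C with (xi * (C / xi)) by (field; lra).
    apply Rmult_le_compat_l; [lra|]. pose proof (pow2_pos s).
    assert (0 < / xi) by now apply Rinv_0_lt_compat. lra. }
  assert (His : 2 ^ s <= INR i).
  { assert (0 < / xi) by now apply Rinv_0_lt_compat.
    assert (0 < C / xi) by now apply Rdiv_lt_0_compat. lra. }
  set (h := block_length i). set (e := / 2 ^ i). set (rho := / (64 * INR h)).
  pose proof (block_growth i ltac:(unfold i; lia)) as Hgrow. fold h e in Hgrow.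
  pose proof (pow2_pos i) as H2i.
  assert (He : 0 < e) by (now apply Rinv_0_lt_compat).
  assert (He1 : 2 * e <= 1).
  { apply Rmult_le_reg_r with (2 ^ i); [easy|]. unfold e.
    rewrite Rmult_assoc, Rinv_l by lra.
    pose proof (pow_R1_Rle 2 (j + 1) ltac:(lra)).
    replace i with (S (j + 1)) by (unfold i; lia). simpl. lra. }
  assert (Eh : INR h * e = 4 * INR i) by (unfold h, e; rewrite INR_block_length; field; lra).
  assert (Hh : 0 < INR h) by (unfold h; rewrite INR_block_length; nra).
  assert (Hih : INR i <= INR h) by nra.
  assert (Hrho : 0 < rho) by (apply Rinv_0_lt_compat; lra).
  assert (Erho : 64 * INR h * rho = 1) by (unfold rho; field; lra).
  assert (Erho' : 256 * INR i * rho = e).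
  { replace (256 * INR i * rho) with (64 * (INR h * e) * rho) by (rewrite Eh; ring).
    replace e with (64 * INR h * rho * e) at 2 by (rewrite Erho; ring). ring. }
  assert (Hrho1 : rho <= / 2) by nra.
  assert (Hrhoxi : rho <= xi * e / 2).
  { rewrite <- Erho'. assert (rho * 1 <= rho * (xi * INR i)) by (apply Rmult_le_compat_l; lra).
    lra. }
  assert (E0 : / 2 ^ j = 4 * e).
  { unfold e, i. rewrite pow_add. simpl. pose proof (pow2_pos j). field. lra. }
  assert (E3 : / 2 ^ (j + 3) = e / 2).
  { unfold e, i. rewrite !pow_add. simpl. pose proof (pow2_pos j). field. lra. }
  rewrite E0, E3 in HW.
  replace (s + j + 2)%nat with (s + i)%nat in HW by (unfold i; lia).
  (* Indices below [n0] are handled by the scale selection; from [n0] on, [xi n0 >= 2 / e] makes the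
     slopes large enough for the density bound. *)
  set (n0 := (2 ^ (s + i))%nat) in *.
  assert (Hn0 : INR n0 = 2 ^ s * 2 ^ i) by (unfold n0; rewrite INR_pow2, pow_add; ring).
  assert (Hn0h : (n0 <= h)%nat).
  { apply INR_le. rewrite Hn0. unfold h. rewrite INR_block_length. nra. }
  (* Chosen so that [h l = 1/2]: two blocks then satisfy the distortion condition. *)
  set (l := e / (8 * INR i)).
  assert (El : 8 * INR i * l = e) by (unfold l; field; lra).
  assert (Hl : 0 < l) by (unfold l; apply Rdiv_lt_0_compat; lra).
  assert (Ehl : INR h * l = / 2) by (unfold l; apply Rmult_eq_reg_r with (8 * INR i);
    [field_simplify; lra|lra]).
  clearbody l rho.
  set (F := fun x => psum (fun m => hits rho xi eta m x / (xi * INR (S m))) n0).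
  destruct (interval_pigeonhole F e l (l / 4) (8 * i)) as (t & Ht & HF).
  { replace (INR (8 * i) * l) with e by (rewrite mult_INR; simpl; lra).
    replace (INR (8 * i) * (l / 4)) with (e / 4) by (rewrite mult_INR; simpl; lra).
    apply Rle_lt_trans with (2 * rho / xi * C).
    - unfold F. rewrite <- psum_minus. eapply Rle_trans; [|apply Rmult_le_compat_l, HW].
      + rewrite <- psum_scal. apply psum_le. intros m _.
        pose proof (INR_S_pos m) as HSm.
        pose proof (hit_len_diff_le_floor rho (orbit xi m e + eta m)
                      (orbit xi m (e + e) + eta m) ltac:(lra)) as HH.
        (* Slopes are at least [xi], so widening [[e, 2e]] to [[e/2, 4e]] moves each end of the
           image by at least [xi e / 2 >= rho], absorbing the [rho] in the floors. *)
        assert (Hstep : forall x y, 0 <= x <= y -> xi * (y - x) <= orbit xi m y - orbit xi m x).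
        { intros x y Hxy. pose proof (orbit_diff_bounds xi x y m Hxi Hxy).
          pose proof (slope_ge xi x m Hxi ltac:(lra)).
          assert (1 <= INR (S m)) by (apply (le_INR 1); lia).
          assert (xi <= slope xi m x) by nra. nra. }
        pose proof (Hstep (e + e) (4 * e) ltac:(lra)).
        pose proof (Hstep (e / 2) e ltac:(lra)).
        assert (F1 : floor (orbit xi m (e + e) + eta m + rho) <= floor (orbit xi m (4 * e) + eta m))
          by (apply floor_le; nra).
        assert (F2 : floor (orbit xi m (e / 2) + eta m) <= floor (orbit xi m e + eta m - rho))
          by (apply floor_le; nra).
        unfold hits.
        match goal with |- ?A / _ - ?B / _ <= 2 * rho / xi * (?W / _) =>
          replace (A / (xi * INR (S m)) - B / (xi * INR (S m)))
            with ((A - B) * / (xi * INR (S m))) by (field; lra);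
          replace (2 * rho / xi * (W / INR (S m)))
            with (2 * rho * W * / (xi * INR (S m))) by (field; lra) end.
        apply Rmult_le_compat_r; [left; apply Rinv_0_lt_compat; nra|].
        eapply Rle_trans; [exact HH|]. apply Rmult_le_compat_l; lra.
      + apply Rmult_le_pos; [lra|left; now apply Rinv_0_lt_compat].
    - apply Rmult_lt_reg_r with xi; [easy|].
      replace (2 * rho / xi * C * xi) with (2 * rho * C) by (field; lra).
      assert (2 * rho * C <= 2 * rho * (xi * INR i)) by (apply Rmult_le_compat_l; lra).
      assert (0 < rho * (xi * INR i)) by nra.
      rewrite <- Erho'. lra. }
  set (u := e + INR t * l) in *.
  assert (Htl : 0 <= INR t * l) by (apply Rmult_le_pos; [apply pos_INR|lra]).
  assert (Htl2 : INR t * l + l <= e).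
  { assert (INR t + 1 <= INR (8 * i)) as Hti by (rewrite <- S_INR; apply le_INR; lia).
    rewrite mult_INR in Hti. simpl (INR 8) in Hti. nra. }
  assert (Hu : e <= u) by (unfold u; lra).
  assert (Hv : u + l <= 2 * e) by (unfold u; lra).
  exists i, u, (u + l). split; [unfold i; lia|]. split; [unfold i; lia|].
  fold h e. unfold stage. replace (u + l - u) with l by ring.
  replace (/ (64 * INR h)) with rho by (apply Rmult_eq_reg_l with (64 * INR h);
    [rewrite Erho; field; lra|lra]).
  assert (Hml : forall m, (m < h)%nat -> INR m * (u + l - u) <= 1).
  { intros m Hm. apply lt_INR in Hm. replace (u + l - u) with l by ring. nra. }
  split; [lra|]. split; [lra|]. split; [lra|]. split; [|split; [|split]].
  - rewrite Nat.mul_1_l. unfold slope.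
    assert (H1 : (1 + e) ^ h <= (1 + u) ^ h) by (apply pow_incr; lra).
    assert (H3 : 1 <= INR h) by lra. rewrite S_INR.
    assert (xi * INR i <= xi * (1 + u) ^ h) by (apply Rmult_le_compat_l; lra).
    assert (Hbig : 384 <= xi * (1 + u) ^ h).
    { apply Rle_trans with (xi * (384 * INR i)); [lra|].
      apply Rmult_le_compat_l; lra. }
    replace (l * (xi * (INR h + 1) * (1 + u) ^ h))
      with ((INR h * l + l) * (xi * (1 + u) ^ h)) by ring.
    nra.
  - rewrite mult_INR. simpl (INR 2). lra.
  - exists (fun m => slope xi m u). split.
    + intros m Hm. simpl. split; [apply slope_pos; lra|]. split; [lra|].
      apply slope_distortion; [lra|lra|now apply Hml].
    + simpl (0 * h + _)%nat.
      replace h with (n0 + (h - n0))%nat at 1 by lia. rewrite psum_split.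
      assert (P1 : psum (fun m => (hits rho xi eta m (u + l) - hits rho xi eta m u)
                                  / slope xi m u) n0 <= l / 4).
      { eapply Rle_trans; [|left; exact HF]. unfold F. rewrite <- psum_minus.
        apply psum_le. intros m _. unfold Rdiv. rewrite <- Rmult_minus_distr_r.
        pose proof (INR_S_pos m).
        pose proof (hits_mono rho xi eta m u (u + l) ltac:(lra) Hxi ltac:(lra)).
        apply Rmult_le_compat_l; [lra|]. apply Rinv_le_contravar; [nra|].
        apply slope_ge; lra. }
      assert (P2 : psum (fun m => (hits rho xi eta (n0 + m) (u + l) - hits rho xi eta (n0 + m) u)
                                  / slope xi (n0 + m) u) (h - n0) <= l / 4); [|simpl in *; lra].
      assert (Hn0xi : 0 < xi * INR n0).
      { rewrite Hn0. pose proof (pow2_pos s). repeat apply Rmult_lt_0_compat; lra. }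
      (* The terms [3 l] add up to at most [3/2] and the geometric series to at most [1], so the
         loss is at most [5 rho = 5 l / 32 < l / 4]. *)
      apply Rle_trans with
        (psum (fun m => 2 * rho * (3 * l + / (xi * INR n0) * / (1 + u) ^ m)) (h - n0)).
      * apply psum_le. intros m Hm.
        eapply Rle_trans; [apply hits_over_slope_le; [lra|lra|lra|apply Hml; lia]|].
        apply Rmult_le_compat_l; [lra|]. replace (u + l - u) with l by ring.
        apply Rplus_le_compat_l. rewrite <- Rinv_mult.
        assert (0 < (1 + u) ^ m) by (apply pow_lt; lra).
        apply Rinv_le_contravar; [now apply Rmult_lt_0_compat|].
        unfold slope. rewrite pow_add.
        assert (1 <= (1 + u) ^ n0) by (apply pow_R1_Rle; lra).
        assert (INR n0 <= INR (S (n0 + m))) by (apply le_INR; lia).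
        apply Rmult_le_compat; [lra|lra|apply Rmult_le_compat_l; lra|nra].
      * rewrite psum_scal, psum_plus, psum_const, psum_scal.
        assert (G : / (xi * INR n0) * psum (fun m => / (1 + u) ^ m) (h - n0) <= 1).
        { apply Rle_trans with (/ (xi * INR n0) * (2 / e)).
          - apply Rmult_le_compat_l; [left; now apply Rinv_0_lt_compat|].
            eapply Rle_trans; [apply geometric_sum_le; lra|].
            unfold Rdiv. apply Rmult_le_compat;
              [lra|left; apply Rinv_0_lt_compat; lra|lra|apply Rinv_le_contravar; lra].
          - rewrite Hn0. pose proof (pow2_pos s).
            replace (/ (xi * (2 ^ s * 2 ^ i)) * (2 / e)) with (2 / xi * / 2 ^ s)
              by (unfold e; field; lra).
            apply Rmult_le_reg_r with (2 ^ s); [easy|].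
            rewrite Rmult_assoc, Rinv_l by lra. lra. }
        assert (Hr : INR (h - n0) <= INR h) by (apply le_INR; lia).
        assert (INR (h - n0) * (3 * l) <= 3 / 2) by nra.
        apply Rle_trans with (2 * rho * (5 / 2)); [apply Rmult_le_compat_l; lra|].
        assert (rho = l / 32); [|lra].
        apply Rmult_eq_reg_l with (INR h); lra.
  - intros m x Hm. simpl in Hm. lia.
Qed.

Theorem theorem2 (M : R) (HM : 0 < M) :
  exists gamma : R, 0 < gamma /\
    forall (xi : R) (eta : nat -> R), xi <> 0 -> -M <= xi <= M ->
    forall delta : R, 0 < delta ->
    exists eps : R, 0 < eps /\ eps < delta /\
      inf_pos_gt (fun n => dist_Z (xi * (1 + eps) ^ n + eta n))
                 (gamma * eps * / Rabs (ln eps)).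
Proof.
  (* With [eps <= 2 / 2^i] and [|ln eps| >= i / 4], the right-hand side is at most
     [8 / 4096 = 1/512] times [1 / (i 2^i)], while the distance is at least [1/256] times it. *)
  exists (/ 4096). split; [lra|]. intros xi eta Hxi _ delta Hdelta.
  assert (exists a, 2 / delta < 2 ^ a) as (a & Ha).
  { destruct (Pow_x_infinity 2 ltac:(rewrite Rabs_right; lra) (2 / delta + 1)) as (a & Ha).
    exists a. specialize (Ha a (Nat.le_refl a)).
    rewrite Rabs_right in Ha by (pose proof (pow2_pos a); lra). lra. }
  assert (exists i x, (a <= i)%nat /\ (5 <= i)%nat /\ / 2 ^ i <= x <= 2 * / 2 ^ i /\
    forall m, far (/ (64 * INR (block_length i))) (xi * (1 + x) ^ S m + eta (S m)))
    as (i & x & Hai & Hi & Hx & Hfar).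
  (* Negating both [xi] and [eta] reduces to positive [xi]; the shift of [eta] matches the exponent
     [S m]. *)
  { assert (Hpos : forall y (th : nat -> R), 0 < y ->
      exists i x, (a <= i)%nat /\ (5 <= i)%nat /\ / 2 ^ i <= x <= 2 * / 2 ^ i /\
        forall m, far (/ (64 * INR (block_length i))) (y * (1 + x) ^ S m + th m)).
    { intros y th Hy. destruct (exists_initial_stage y th a Hy) as (i & u & v & Hai & Hi & H0).
      apply stage_limit in H0.
      - destruct H0 as (x & Hx & Hfar). exists i, x. auto.
      - easy.
      - apply Rinv_0_lt_compat, pow2_pos.
      - unfold block_length. assert (1 <= 2 ^ i)%nat; [|nia].
        pose proof (Nat.pow_nonzero 2 i). lia.
      - reflexivity.
      - now apply block_growth. }
    destruct (Rlt_le_dec 0 xi) as [Hp|Hn].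
    - exact (Hpos xi (fun m => eta (S m)) Hp).
    - destruct (Hpos (- xi) (fun m => - eta (S m))) as (i & x & H1 & H2 & H3 & H4); [lra|].
      exists i, x. repeat split; try easy; try lra. intros m. specialize (H4 m).
      apply far_opp in H4. eapply eq_rect; [exact H4|]. ring. }
  pose proof (pow2_pos i) as H2i. pose proof (Rinv_0_lt_compat _ H2i) as He.
  assert (Hi5 : 5 <= INR i) by (apply le_INR in Hi; simpl in Hi; lra).
  exists x. split; [lra|]. split.
  - apply Rle_lt_trans with (2 * / 2 ^ a).
    + assert (/ 2 ^ i <= / 2 ^ a); [|lra].
      apply Rinv_le_contravar; [apply pow2_pos|]. apply Rle_pow; [lra|easy].
    + pose proof (pow2_pos a) as H2a. apply Rmult_lt_reg_r with (2 ^ a); [easy|].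
      rewrite Rmult_assoc, Rinv_l by lra.
      apply (Rmult_lt_compat_l delta) in Ha; [|easy].
      replace (delta * (2 / delta)) with 2 in Ha by (field; lra). lra.
  - exists (/ (64 * INR (block_length i))). split.
    + assert (Hln : INR i / 4 <= Rabs (ln x)).
      { assert (Hlnx : ln x <= - (INR i - 1) * ln 2).
        { apply Rle_trans with (ln (2 * / 2 ^ i)).
          - destruct (proj2 Hx) as [Hlt|Heq]; [left; apply ln_increasing; lra|rewrite Heq; lra].
          - rewrite ln_mult, ln_Rinv, ln_pow by lra. lra. }
        pose proof ln_lt_2. rewrite <- Rabs_Ropp.
        eapply Rle_trans; [|apply Rle_abs]. nra. }
      rewrite INR_block_length.
      apply Rle_lt_trans with (/ 4096 * (2 * / 2 ^ i) * / (INR i / 4)).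
      * apply Rmult_le_compat; [lra|left; apply Rinv_0_lt_compat; lra|lra|].
        apply Rinv_le_contravar; lra.
      * replace (/ 4096 * (2 * / 2 ^ i) * / (INR i / 4))
          with (/ 512 * (/ 2 ^ i * / INR i)) by (field; lra).
        replace (/ (64 * (4 * INR i * 2 ^ i))) with (/ 256 * (/ 2 ^ i * / INR i))
          by (field; lra).
        assert (0 < / 2 ^ i * / INR i)
          by (apply Rmult_lt_0_compat; [easy|apply Rinv_0_lt_compat; lra]).
        lra.
    + intros n Hn. apply far_dist_Z. destruct n as [|m]; [lia|]. apply Hfar.
Qed.
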